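(* Let $f(x)=\frac1n\sum_{i=1}^n f_i(x)$ with each $f_i:\mathbb{R}^d\to\mathbb{R}$ differentiable, let $x^*$ be a minimizer of $f$, and assume there is $\mu>0$ with $f(x^* )\ge f(x)+\langle\nabla f(x),x^*-x\rangle+\frac{\mu}{2}\|x^*-x\|_2^2$ for all $x\in\mathbb{R}^d$. Let $\mathbf W\succ0$ be a symmetric positive definite $n\times n$ matrix and $\mathcal D$ a distribution of random matrices $\mathbf S\in\mathbb{R}^{n\times\tau}$, and let $\theta_{\mathbf S}$ be a random variable (a function of $\mathbf S$) such that $\mathbb{E}_{\mathcal D}[\theta_{\mathbf S}\Pi_{\mathbf S}e]=e$. Assume there are constants $\mathcal L_1>0$, $\mathcal L_2>0$ with $$\mathbb{E}_{\mathcal D}\|\nabla f_{\mathbf S}(x)-\nabla f_{\mathbf S}(x^* )\|_2^2\le 2\mathcal L_1(f(x)-f(x^* )),\qquad \mathbb{E}_{\mathcal D}\|(\mathbf{G}(x)-\mathbf{G}(x^* ))\Pi_{\mathbf S}\|_{\mathbf W^{-1}}^2\le 2\mathcal L_2(f(x)-f(x^* ))$$ for all $x\in\mathbb{R}^d$. Assume $\kappa>0$, and let $\rho=\lambda_{\max}\big(\mathbf W^{1/2}(\mathbb{E}_{\mathcal D}[\theta_{\mathbf S}^2\Pi_{\mathbf S}ee^\top\Pi_{\mathbf S}^\top]-ee^\top)\mathbf W^{1/2}\big)\ge0$. Choose any $x^0\in\mathbb{R}^d$, $\mathbf J^0\in\mathbb{R}^{d\times n}$, let $\{x^k,\mathbf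 J^k\}$ be the iterates of JacSketch, and let $$\Psi^k=\|x^k-x^*\|_2^2+\frac{\alpha}{2\mathcal L_2}\|\mathbf J^k-\mathbf{G}(x^* )\|_{\mathbf W^{-1}}^2 .$$ If $0\le\alpha\le\min\left\{\frac{1}{4\mathcal L_1},\frac{\kappa}{4\mathcal L_2\rho/n^2+\mu}\right\}$, then $\mathbb{E}[\Psi^k]\le(1-\mu\alpha)^k\Psi^0$ for all $k$. If $\alpha$ equals this upper bound, then $k\ge\max\left\{\frac{4\mathcal L_1}{\mu},\ \frac1\kappa+\frac{4\rho\mathcal L_2}{\kappa\mu n^2}\right\}\log\frac1\epsilon$ implies $\mathbb{E}[\Psi^k]\le\epsilon\Psi^0$.
   Context: $\mathbf{G}(x)=[\nabla f_1(x),\dots,\nabla f_n(x)]\in\mathbb{R}^{d\times n}$ is the Jacobian; $e\in\mathbb{R}^n$ is the all-ones vector; $F(x)=(f_1(x),\dots,f_n(x))^\top$. For $\mathbf X\in\mathbb{R}^{d\times n}$, $\|\mathbf X\|_{\mathbf W^{-1}}=\sqrt{\mathrm{Tr}(\mathbf X\mathbf W^{-1}\mathbf X^\top)}$. $\Pi_{\mathbf S}=\mathbf S(\mathbf S^\top\mathbf W\mathbf S)^\dagger\mathbf S^\top\mathbf W$ ($\dagger$ = Moore–Penrose pseudoinverse), $\mathbf H_{\mathbf S}=\mathbf S(\mathbf S^\top\mathbf W\mathbf S)^\dagger\mathbf S^\top$. $f_{\mathbf S}(x)=\frac{\theta_{\mathbf S}}{n}\langle F(x),\Pi_{\mathbf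 S}e\rangle$, so $\nabla f_{\mathbf S}(x)=\frac{\theta_{\mathbf S}}{n}\mathbf{G}(x)\Pi_{\mathbf S}e$. $\kappa=\lambda_{\min}(\mathbb{E}_{\mathcal D}[\Pi_{\mathbf S}])$ (this matrix is similar to the symmetric matrix $\mathbf W^{1/2}\mathbb{E}[\mathbf H_{\mathbf S}]\mathbf W^{1/2}$). JacSketch with stepsize $\alpha>0$: for $k=0,1,\dots$, sample $\mathbf S_k\sim\mathcal D$ independently of the past, set $\mathbf J^{k+1}=\mathbf J^k+(\mathbf{G}(x^k)-\mathbf J^k)\Pi_{\mathbf S_k}$, $g^k=\frac1n\mathbf J^ke+\frac{\theta_{\mathbf S_k}}{n}(\mathbf{G}(x^k)-\mathbf J^k)\Pi_{\mathbf S_k}e$, $x^{k+1}=x^k-\alpha g^k$. $\mathbb{E}$ is total expectation over the algorithm's randomness. *)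

(* Defs.v *)
From HB Require Import structures.
From mathcomp Require Import all_boot all_order all_algebra.
From mathcomp Require Import all_classical all_reals all_analysis.
From Stdlib Require Import ClassicalEpsilon.

Set Implicit Arguments.
Unset Strict Implicit.
Unset Printing Implicit Defensive.

Import Order.TTheory GRing.Theory Num.Theory.
Import numFieldNormedType.Exports.
Local Open Scope ring_scope.

Section JacSketchDefs.
Variable R : realType.

Definition sqnorm {m : nat} (v : 'cV[R]_m) : R := \sum_(i < m) v i 0 ^+ 2.
Definition dotv {m : nat} (u v : 'cV[R]_m) : R := \sum_(i < m) u i 0 * v i 0.

Definition wnorm2 {m n : nat} (W : 'M[R]_n) (X : 'M[R]_(m, n)) : R :=
  \tr (X *m invmx W *m X^T).

Definition symmetric {n : nat} (A : 'M[R]_n) : Prop := A^T = A.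

Definition pos_def {n : nat} (A : 'M[R]_n) : Prop :=
  symmetric A /\ forall v : 'cV[R]_n, v != 0 -> 0 < (v^T *m A *m v) 0 0.

Definition penrose {m n : nat} (A : 'M[R]_(m, n)) (B : 'M[R]_(n, m)) : Prop :=
  [/\ A *m B *m A = A, B *m A *m B = B, (A *m B)^T = A *m B & (B *m A)^T = B *m A].

Definition mp_pinv {m n : nat} (A : 'M[R]_(m, n)) : 'M[R]_(n, m) :=
  epsilon (inhabits 0) (penrose A).

Definition PiS {n tau : nat} (W : 'M[R]_n) (S : 'M[R]_(n, tau)) : 'M[R]_n :=
  S *m mp_pinv (S^T *m W *m S) *m S^T *m W.

Definition ones (n : nat) : 'cV[R]_n := const_mx 1.

Definition is_lambda_min {n : nat} (A : 'M[R]_n) (a : R) : Prop :=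
  eigenvalue A a /\ forall b, eigenvalue A b -> a <= b.
Definition is_lambda_max {n : nat} (A : 'M[R]_n) (a : R) : Prop :=
  eigenvalue A a /\ forall b, eigenvalue A b -> b <= a.

Definition is_gradient {m : nat} (f : 'cV[R]_m -> R) (g : 'cV[R]_m -> 'cV[R]_m) : Prop :=
  forall x, differentiable f x /\ forall v, 'd f x v = dotv (g x) v.

Definition jac {d n : nat} (gradf : 'I_n -> 'cV[R]_d -> 'cV[R]_d) (x : 'cV[R]_d)
  : 'M[R]_(d, n) := \matrix_(a < d, i < n) gradf i x a 0.

Definition favg {d n : nat} (f : 'I_n -> 'cV[R]_d -> R) (x : 'cV[R]_d) : R :=
  n%:R^-1 * \sum_(i < n) f i x.
Definition gavg {d n : nat} (gradf : 'I_n -> 'cV[R]_d -> 'cV[R]_d) (x : 'cV[R]_d)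
  : 'cV[R]_d := n%:R^-1 *: \sum_(i < n) gradf i x.

Definition Emx {dO} {O : measurableType dO} (P : probability O R) {p q : nat}
  (M : O -> 'M[R]_(p, q)) : 'M[R]_(p, q) :=
  \matrix_(i < p, j < q) fine (\int[P]_w ((M w i j)%:E))%E.

Definition jac_step {dO} {O : measurableType dO} {d n tau : nat}
  (gradf : 'I_n -> 'cV[R]_d -> 'cV[R]_d) (W : 'M[R]_n)
  (S : O -> 'M[R]_(n, tau)) (theta : O -> R) (alpha : R)
  (s : 'cV[R]_d * 'M[R]_(d, n)) (w : O) : 'cV[R]_d * 'M[R]_(d, n) :=
  let x := s.1 in let J := s.2 in
  let Pi := PiS W (S w) in
  let g := n%:R^-1 *: (J *m ones n)
           + (theta w / n%:R) *: ((jac gradf x - J) *m Pi *m ones n) in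
  (x - alpha *: g, J + (jac gradf x - J) *m Pi).

Definition Psi {d n : nat} (gradf : 'I_n -> 'cV[R]_d -> 'cV[R]_d) (W : 'M[R]_n)
  (xstar : 'cV[R]_d) (L2 alpha : R) (s : 'cV[R]_d * 'M[R]_(d, n)) : R :=
  sqnorm (s.1 - xstar) + alpha / (2 * L2) * wnorm2 W (s.2 - jac gradf xstar).

(* Total expectation E[Psi^k] of the Lyapunov function after k JacSketch steps
   started at state s, the samples S_0, S_1, ... being i.i.d. with law P
   (iterated integration over the independent samples). *)
Fixpoint EPsi {dO} {O : measurableType dO} (P : probability O R) {d n tau : nat}
  (gradf : 'I_n -> 'cV[R]_d -> 'cV[R]_d) (W : 'M[R]_n)
  (S : O -> 'M[R]_(n, tau)) (theta : O -> R) (xstar : 'cV[R]_d) (L2 alpha : R)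
  (k : nat) (s : 'cV[R]_d * 'M[R]_(d, n)) : \bar R :=
  match k with
  | 0 => (Psi gradf W xstar L2 alpha s)%:E
  | k'.+1 => (\int[P]_w
       EPsi P gradf W S theta xstar L2 alpha k' (jac_step gradf W S theta alpha s w))%E
  end.

End JacSketchDefs.

(* Main.v *)
(** Let [Gs] be the Jacobian at the minimizer, [t = theta Pi e], [D = G x - Gs] and
    [Y = J - Gs]; [Gs e = 0] by optimality. The estimator splits as
    [g = D t / n + Y (e - t) / n]; the first term is controlled by [L1], and since
    [E t = e] the second one has mean square
    [tr (Y (E[t t^T] - e e^T) Y^T) / n^2 <= rho / n^2 |Y|_{W^-1}^2].
    As [Pi] is an orthogonal projection for the [W^-1] inner product acting on rows,
    Pythagoras gives [|Y + (D - Y) Pi|^2 = |Y|^2 - tr (Y Pi W^-1 Y^T) + |D Pi|^2],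
    whose expectation is at most [(1 - kappa) |Y|^2 + 2 L2 (f x - min f)]. Adding the
    strong convexity inequality, every step contracts [Psi] in mean by
    [1 - mu alpha]. All the quantities averaged are linear in [t], [t t^T] and [Pi],
    whose entries are integrable. *)

Require Import Defs.
From HB Require Import structures.
From mathcomp Require Import all_boot all_order all_algebra.
From mathcomp Require Import all_classical all_reals all_analysis.
From mathcomp Require Import ring lra.

Import Order.TTheory GRing.Theory Num.Theory.
Import numFieldNormedType.Exports.
Local Open Scope ring_scope.

Set Implicit Arguments.
Unset Strict Implicit.
Unset Printing Implicit Defensive.

(** * The orthogonal projection [Pi] and the weighted norm *)

Lemma trace_mulmx_trmx (R : pzRingType) (m n : nat) (A : 'M[R]_(m, n)) :
  \tr (A *m A^T) = \sum_i \sum_j A i j ^+ 2.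
Proof.
apply: eq_bigr => i _; rewrite mxE; apply: eq_bigr => j _.
by rewrite mxE expr2.
Qed.

Lemma trace_mulmx_trmx_ge0 (R : realDomainType) (m n : nat) (A : 'M[R]_(m, n)) :
  0 <= \tr (A *m A^T).
Proof.
by rewrite trace_mulmx_trmx; do 2 apply: sumr_ge0 => ? _; rewrite sqr_ge0.
Qed.

Lemma trace_mulmx_trmx_eq0 (R : realDomainType) (m n : nat) (A : 'M[R]_(m, n)) :
  \tr (A *m A^T) = 0 -> A = 0.
Proof.
rewrite trace_mulmx_trmx => A0; apply/matrixP => i j; rewrite mxE.
have sq_ge0 k : 0 <= \sum_l A k l ^+ 2 by apply: sumr_ge0 => l _; exact: sqr_ge0.
have Ai0 : \sum_l A i l ^+ 2 = 0.
  by move: A0 => /psumr_eq0P; apply => // k _; exact: sq_ge0.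
have /eqP : A i j ^+ 2 = 0.
  by move: Ai0 => /psumr_eq0P; apply => // l _; exact: sqr_ge0.
by rewrite sqrf_eq0 => /eqP.
Qed.

(** If [K] spans the left kernel of [A A^T], then [(K A)(K A)^T = 0], hence [K A = 0], and
    independence of the rows of [A] gives [K = 0]. *)
Lemma row_free_gram_unitmx (R : realFieldType) (m n : nat) (A : 'M[R]_(m, n)) :
  row_free A -> A *m A^T \in unitmx.
Proof.
move=> Afree; rewrite -row_free_unit -kermx_eq0; apply/eqP.
set K := kermx _.
have KA0 : K *m A = 0.
  apply: trace_mulmx_trmx_eq0.
  by rewrite trmx_mul mulmxA -(mulmxA K) mulmx_ker mul0mx mxtrace0.
by apply: (can_inj (mulmxKp Afree)); rewrite /= KA0 mul0mx.
Qed.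

Lemma penrose_trmx (R : realType) (m n : nat) (A : 'M[R]_(m, n))
    (B : 'M[R]_(n, m)) : penrose A B -> penrose A^T B^T.
Proof.
case=> ABA BAB ABs BAs.
by split; rewrite -!trmx_mul ?mulmxA ?ABA ?BAB ?ABs ?BAs.
Qed.

(** Transposing [B A = (B A)(C A)], whose factors are symmetric, gives [B A = C A]; likewise
    [A B = A C]. Then [B = B A B = C A B = C A C = C]. *)
Lemma penrose_unique (R : realType) (m n : nat) (A : 'M[R]_(m, n))
    (B C : 'M[R]_(n, m)) : penrose A B -> penrose A C -> B = C.
Proof.
case=> ABA BAB ABs BAs [ACA CAC ACs CAs].
have BACA : B *m A = C *m A.
  have e : B *m A = B *m A *m (C *m A) by rewrite -{1}ACA !mulmxA.
  by rewrite -BAs e trmx_mul BAs CAs mulmxA -(mulmxA C) -(mulmxA C) ABA.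
have ABAC : A *m B = A *m C.
  have e : A *m B = A *m C *m (A *m B) by rewrite mulmxA ACA.
  by rewrite -ABs e trmx_mul ABs ACs mulmxA ABA.
by rewrite -BAB BACA -mulmxA ABAC mulmxA CAC.
Qed.

(* Full-rank factorization: if [A = C F] with [C] of full column rank and [F]
   of full row rank, then [F^T (F F^T)^-1 (C^T C)^-1 C^T] is a Moore-Penrose
   inverse of [A]. *)
Lemma penrose_exists (R : realType) (m n : nat) (A : 'M[R]_(m, n)) :
  exists B, penrose A B.
Proof.
have [r [C [F [AE FF CC]]]] : exists (r : nat) (C : 'M[R]_(m, r)) (F : 'M[R]_(r, n)),
    [/\ A = C *m F, F *m F^T \in unitmx & C^T *m C \in unitmx].
  exists (\rank A), (col_base A), (row_base A); split; first by rewrite mulmx_base.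
    by apply: row_free_gram_unitmx; exact: row_base_free.
  rewrite -{2}(trmxK (col_base A)); apply: row_free_gram_unitmx.
  by rewrite /row_free mxrank_tr; exact: col_base_full.
pose F' := F^T *m invmx (F *m F^T); pose C' := invmx (C^T *m C) *m C^T.
have FF' : F *m F' = 1%:M by rewrite mulmxA mulmxV.
have C'C : C' *m C = 1%:M by rewrite -mulmxA mulVmx.
have F'F : (F' *m F)^T = F' *m F.
  by rewrite /F' !trmx_mul trmx_inv trmx_mul trmxK mulmxA.
have CC' : (C *m C')^T = C *m C'.
  by rewrite /C' !trmx_mul trmx_inv trmx_mul trmxK mulmxA.
exists (F' *m C');
have AB : A *m (F' *m C') = C *m C'.
  by rewrite AE mulmxA -(mulmxA C) FF' mulmx1.
have BA : F' *m C' *m A = F' *m F.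
  by rewrite AE mulmxA -(mulmxA F') C'C mulmx1.
split; rewrite ?AB ?BA //.
  by rewrite AE mulmxA -(mulmxA C) C'C mulmx1.
by rewrite mulmxA -(mulmxA F') FF' mulmx1.
Qed.

Lemma mp_pinvP (R : realType) (m n : nat) (A : 'M[R]_(m, n)) :
  penrose A (mp_pinv A).
Proof. by rewrite /mp_pinv; apply: ClassicalEpsilon.epsilon_spec; exact: penrose_exists. Qed.

Lemma trmx_mp_pinv (R : realType) (m : nat) (A : 'M[R]_m) :
  A^T = A -> (mp_pinv A)^T = mp_pinv A.
Proof.
move=> As; apply: (@penrose_unique _ _ _ A); last exact: mp_pinvP.
by rewrite -{1}As; exact/penrose_trmx/mp_pinvP.
Qed.

Lemma pos_def_unitmx (R : realType) (n : nat) (A : 'M[R]_n) :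
  pos_def A -> A \in unitmx.
Proof.
move=> [As Apos]; rewrite -row_free_unit -kermx_eq0; apply/rowV0P => v /sub_kermxP vA0.
apply: contrapT => /eqP v0; have /Apos : v^T != 0 by rewrite trmx_eq0.
by rewrite trmxK vA0 mul0mx mxE ltxx.
Qed.

Section Projection.
Variables (R : realType) (n tau : nat) (W : 'M[R]_n).
Hypothesis hW : pos_def W.
Variable S : 'M[R]_(n, tau).

Lemma PiS_idem : PiS W S *m PiS W S = PiS W S.
Proof.
have [_ BAB _ _] := mp_pinvP (S^T *m W *m S).
by rewrite /PiS -{3}BAB !mulmxA.
Qed.

(** Both sides equal [S (S^T W S)^+ S^T], because the pseudoinverse of a symmetric matrix is
    symmetric. Together with idempotence this makes [Pi] an orthogonal projection of rows for the
    [W^-1] inner product. *)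
Lemma PiS_selfadjoint : PiS W S *m invmx W = invmx W *m (PiS W S)^T.
Proof.
have Wu := pos_def_unitmx hW; have Ws : W^T = W := hW.1.
rewrite /PiS mulmxK // !trmx_mul trmxK Ws trmx_mp_pinv ?mulmxA ?mulVmx ?mul1mx //.
by rewrite !trmx_mul trmxK Ws mulmxA.
Qed.

End Projection.

Section WeightedNorm.
Variables (R : realType) (n : nat) (W W12 : 'M[R]_n).
Hypotheses (hW12 : pos_def W12) (hW12sq : W12 *m W12 = W).

Lemma invmx_sqrt : invmx W = invmx W12 *m (invmx W12)^T.
Proof.
have u := pos_def_unitmx hW12.
rewrite trmx_inv (hW12.1 : W12^T = W12).
have Wu : W \in unitmx by rewrite -hW12sq unitmx_mul u.
apply: (can_inj (mulKmx Wu)); rewrite mulmxV // -hW12sq mulmxA.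
by rewrite mulmxK // mulmxV.
Qed.

(** The weighted norm becomes the Frobenius norm of [X W12^-1], so unweighted spectral bounds
    apply. *)
Lemma wnorm2_sqrt (m : nat) (X : 'M[R]_(m, n)) :
  wnorm2 W X = \tr (X *m invmx W12 *m (X *m invmx W12)^T).
Proof. by rewrite /wnorm2 invmx_sqrt trmx_mul !mulmxA. Qed.

Lemma wnorm2_ge0 (m : nat) (X : 'M[R]_(m, n)) : 0 <= wnorm2 W X.
Proof. by rewrite wnorm2_sqrt trace_mulmx_trmx_ge0. Qed.

End WeightedNorm.

Section PythagorasW.
Variables (R : realType) (d n : nat) (W Pi : 'M[R]_n).
Hypotheses (Pi_idem : Pi *m Pi = Pi)
  (Pi_adj : Pi *m invmx W = invmx W *m Pi^T).

Lemma wnorm2_proj (X : 'M[R]_(d, n)) :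
  wnorm2 W (X *m Pi) = \tr (X *m Pi *m invmx W *m X^T).
Proof.
rewrite /wnorm2 trmx_mul mulmxA -(mulmxA _ (invmx W)) -Pi_adj.
by rewrite mulmxA -(mulmxA X Pi Pi) Pi_idem.
Qed.

Lemma wnorm2_proj_split (Y D : 'M[R]_(d, n)) :
  wnorm2 W (Y + (D - Y) *m Pi)
  = wnorm2 W Y - \tr (Y *m Pi *m invmx W *m Y^T) + wnorm2 W (D *m Pi).
Proof.
(* The new error is [Y Q + D Pi] with complementary projections; moving each transposed projection
   across [W^-1] puts two projections side by side, and [Q Pi = Pi Q = 0] removes the cross
   terms. *)
pose Q := 1%:M - Pi.
have Q_adj : Q *m invmx W = invmx W *m Q^T.
  by rewrite mulmxBl mul1mx linearB /= trmx1 mulmxBr mulmx1 Pi_adj.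
have QQ : Q *m Q = Q by rewrite mulmxBl mul1mx mulmxBr mulmx1 Pi_idem subrr subr0.
have QPi : Q *m Pi = 0 by rewrite mulmxBl mul1mx Pi_idem subrr.
have PiQ : Pi *m Q = 0 by rewrite mulmxBr mulmx1 Pi_idem subrr.
have -> : Y + (D - Y) *m Pi = Y *m Q + D *m Pi.
  by rewrite mulmxBl [Y *m Q]mulmxBr mulmx1 addrA addrAC.
have -> : wnorm2 W Y - \tr (Y *m Pi *m invmx W *m Y^T)
   = \tr (Y *m Q *m invmx W *m Y^T).
  by rewrite /Q mulmxBr mulmx1 !mulmxBl linearB.
clearbody Q; rewrite /wnorm2 [(_ + _)^T]linearD /= !mulmxDl !mulmxDr !linearD /= !trmx_mul.
rewrite [Y *m Q *m invmx W *m (Q^T *m _)]mulmxA -(mulmxA (Y *m Q) _ Q^T) -Q_adj.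
rewrite [Y *m Q *m invmx W *m (Pi^T *m _)]mulmxA -(mulmxA (Y *m Q) _ Pi^T) -Pi_adj.
rewrite [D *m Pi *m invmx W *m (Q^T *m _)]mulmxA -(mulmxA (D *m Pi) _ Q^T) -Q_adj.
rewrite !mulmxA -(mulmxA Y Q Q) QQ -(mulmxA Y Q Pi) QPi -(mulmxA D Pi Q) PiQ.
by rewrite !mulmx0 !mul0mx !mxtrace0 addr0 add0r.
Qed.

End PythagorasW.

(** * Rayleigh quotients of symmetric matrices *)

Lemma trace_quadD (R : realType) (m n : nat) (M : 'M[R]_n)
    (X Y : 'M[R]_(m, n)) (t : R) : M^T = M ->
  \tr ((X + t *: Y) *m M *m (X + t *: Y)^T)
  = \tr (X *m M *m X^T) + 2 * t * \tr (X *m M *m Y^T)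
    + t ^+ 2 * \tr (Y *m M *m Y^T).
Proof.
move=> Ms; have YX : \tr (Y *m M *m X^T) = \tr (X *m M *m Y^T).
  by rewrite -mxtrace_tr !trmx_mul trmxK Ms mulmxA.
rewrite linearD linearZ /= !mulmxDl !mulmxDr -!scalemxAl -!scalemxAr !linearD /=.
rewrite !linearZ /= YX; ring.
Qed.

Lemma trace_quadE (R : pzRingType) (m n : nat) (M : 'M[R]_n) (X : 'M[R]_(m, n)) :
  \tr (X *m M *m X^T) = \sum_i \sum_j (X *m M) i j * X i j.
Proof.
by apply: eq_bigr => i _; rewrite mxE; apply: eq_bigr => j _; rewrite [X^T j i]mxE.
Qed.

Lemma trace_quad_rows (R : pzRingType) (m n : nat) (M : 'M[R]_n)
    (X : 'M[R]_(m, n)) :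
  \tr (X *m M *m X^T) = \sum_i \tr (row i X *m M *m (row i X)^T).
Proof.
rewrite trace_quadE; apply: eq_bigr => i _.
rewrite trace_quadE big_ord1; apply: eq_bigr => j _.
by rewrite -row_mul !mxE.
Qed.

Lemma continuous_trace_quad (R : realType) (n : nat) (M : 'M[R]_n) :
  continuous (fun v : 'rV[R]_n => \tr (v *m M *m v^T)).
Proof.
have -> : (fun v : 'rV[R]_n => \tr (v *m M *m v^T))
    = (fun v : 'rV[R]_n => \sum_j (\sum_k v 0 k * M k j) * v 0 j).
  apply/funext => v; rewrite trace_quadE big_ord1.
  by apply: eq_bigr => j _; rewrite mxE.
apply: continuous_big => [|j _ v]; first by apply: add_continuous.
apply: continuousM; last exact: coord_continuous.
apply: continuous_big => [|k _ w]; first by apply: add_continuous.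
by apply: continuousM; [exact: coord_continuous|exact: cst_continuous].
Qed.

(* The maximum of the Rayleigh quotient is attained on the unit sphere, and a
   maximizer is an eigenvector. *)
Lemma sym_quad_row_ub (R : realType) (n : nat) (M : 'M[R]_n) (a : R) :
  M^T = M -> (forall b, eigenvalue M b -> b <= a) ->
  forall u : 'rV[R]_n, \tr (u *m M *m u^T) <= a * \tr (u *m u^T).
Proof.
move=> Ms Ma u.
have [->|u0] := eqVneq u 0; first by rewrite !mul0mx !mxtrace0 mulr0.
pose K := [set v : 'rV[R]_n | \tr (v *m v^T) = 1]%classic.
have norm_cont : continuous (fun v : 'rV[R]_n => \tr (v *m v^T)).
  by have := @continuous_trace_quad R n 1%:M; under eq_fun do rewrite mulmx1.
have tr_pos (v : 'rV[R]_n) : v != 0 -> 0 < \tr (v *m v^T).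
  move=> v0; rewrite lt_def trace_mulmx_trmx_ge0 andbT.
  by apply: contra v0 => /eqP v0; apply/eqP/trace_mulmx_trmx_eq0.
have nrm (v : 'rV[R]_n) : v != 0 -> K ((Num.sqrt (\tr (v *m v^T)))^-1 *: v).
  move=> /tr_pos v0; rewrite /K /= linearZ /= -scalemxAl -scalemxAr !linearZ /=.
  by rewrite mulrA -expr2 exprVn sqr_sqrtr ?ltW // mulVf // gt_eqF.
have K0 : (K !=set0)%classic by exists ((Num.sqrt (\tr (u *m u^T)))^-1 *: u); exact: nrm.
have Kc : compact K.
  apply: bounded_closed_compact.
    exists 1; split; first exact: num_real.
    move=> x x1 v /= vK; apply: le_trans (ltW x1).
    rewrite [leLHS]mx_normrE; apply/bigmax_leP; split => // -[i j] _ /=.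
    rewrite -[leRHS]sqrtr1 -sqrtr_sqr ler_wsqrtr // -[leRHS]vK.
    rewrite trace_mulmx_trmx (bigD1 i) //= (bigD1 j) //= -addrA lerDl.
    by rewrite addr_ge0 // ?sumr_ge0 // => *; rewrite ?sumr_ge0 // => *; rewrite sqr_ge0.
  have -> : K = ((fun v : 'rV[R]_n => \tr (v *m v^T)) @^-1` [set 1])%classic by [].
  by apply: preimage_closed; [move=> ? _; exact: norm_cont|exact: closed_eq].
have qc : ({within K, continuous (fun v : 'rV[R]_n => \tr (v *m M *m v^T))})%classic.
  by apply: continuous_subspaceT; exact: continuous_trace_quad.
have [c] := EVT_max_rV K0 Kc qc; rewrite inE => cK cmax.
set m := \tr (c *m M *m c^T) in cmax.
(* The maximum over the unit sphere extends to all vectors by homogeneity. *)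
have qm (v : 'rV[R]_n) : \tr (v *m M *m v^T) <= m * \tr (v *m v^T).
  have [->|v0] := eqVneq v 0; first by rewrite !mul0mx !mxtrace0 mulr0.
  have := cmax _ (mem_set (nrm _ v0)).
  rewrite linearZ /= -!scalemxAl -!scalemxAr !linearZ /= mulrA -expr2 exprVn.
  by rewrite sqr_sqrtr ?(ltW (tr_pos _ v0)) // mulrC ler_pdivrMr ?tr_pos.
suff cM : c *m M = m *: c.
  apply: le_trans (qm u) _; rewrite ler_wpM2r ?trace_mulmx_trmx_ge0 //.
  apply: Ma; apply/eigenvalueP; exists c => //.
  by apply: contra_eq_neq cK => ->; rewrite mul0mx mxtrace0 eq_sym oner_neq0.
(* To show that the residual [y] vanishes, the maximizer is perturbed to [c + t y]. Maximality then
   reads [0 <= 2 t p + t^2 r] for every [t], with [p = |y|^2] and [r >= 0], which forces [p = 0]. *)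
pose y := m *: c - c *m M.
suff y0 : y = 0 by apply/eqP; rewrite eq_sym -subr_eq0; exact/eqP.
pose p := \tr (y *m y^T); pose r := m * p - \tr (y *m M *m y^T).
have r0 : 0 <= r by rewrite subr_ge0 qm.
have pE : p = m * \tr (c *m y^T) - \tr (c *m M *m y^T).
  by rewrite /p {1}/y mulmxBl linearB /= -scalemxAl linearZ.
have ineq t : 0 <= 2 * t * p + t ^+ 2 * r.
  have := qm (c + t *: y); rewrite -subr_ge0.
  have := @trace_quadD R 1 n 1%:M c y t (trmx1 _ _); rewrite !mulmx1 => ->.
  rewrite trace_quadD // -/m cK /r -/p {2}pE; congr (0 <= _). ring.
have p0 : p = 0.
  have r1 : r + 1 != 0 by rewrite gt_eqF // ltr_wpDl.
  (* A small negative [t] is needed; dividing by [r + 1] instead of [r] covers [r = 0]. *)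
  have := ineq (- p / (r + 1)).
  have -> : 2 * (- p / (r + 1)) * p + (- p / (r + 1)) ^+ 2 * r
      = - (p ^+ 2 * (r + 2) / (r + 1) ^+ 2) by field.
  rewrite oppr_ge0 pmulr_lle0 ?invr_gt0 ?exprn_gt0 ?ltr_wpDl //.
  rewrite pmulr_lle0 ?ltr_wpDl // => p2.
  by apply/eqP; rewrite -sqrf_eq0 eq_le p2 sqr_ge0.
exact: trace_mulmx_trmx_eq0.
Qed.

Lemma sym_quad_ub (R : realType) (m n : nat) (M : 'M[R]_n) (a : R) :
  M^T = M -> (forall b, eigenvalue M b -> b <= a) ->
  forall X : 'M[R]_(m, n), \tr (X *m M *m X^T) <= a * \tr (X *m X^T).
Proof.
move=> Ms Ma X; rewrite -[X in _ <= _ * \tr (X *m _)]mulmx1 !trace_quad_rows mulr_sumr.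
by apply: ler_sum => i _; rewrite mulmx1; exact: sym_quad_row_ub.
Qed.

(** * Integrals and gradients *)

(* No measurability is assumed, unlike in [ge0_le_integral]. *)
Lemma ge0_le_integral_nonmeasurable (R : realType) (dO : measure_display)
    (O : measurableType dO) (P : {measure set O -> \bar R}) (f g : O -> \bar R) :
  (forall w, (0 <= f w)%E) -> (forall w, (f w <= g w)%E) ->
  (\int[P]_w f w <= \int[P]_w g w)%E.
Proof.
move=> f0 fg; have g0 w : (0 <= g w)%E := le_trans (f0 w) (fg w).
(* Each integral is a supremum over simple functions lying below the integrand, and every simple
   function below [f] is below [g]. *)
rewrite !ge0_integralTE //; apply: le_ereal_sup => _ [h hf <-].
by exists h => // w; exact: le_trans (hf w) (fg w).
Qed.

Section Mean.
Variables (R : realType) (dO : measure_display) (O : measurableType dO).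
Variable P : probability O R.

(** Integrability and value are bundled so that linear combinations carry both, and so that
    computing one mean in two ways yields an identity. *)
Definition mean_is (X : O -> R) (e : R) : Prop :=
  P.-integrable setT (EFin \o X) /\ \int[P]_w X w = e.

Lemma mean_is_unique X e1 e2 : mean_is X e1 -> mean_is X e2 -> e1 = e2.
Proof. by move=> [_ <-] [_ <-]. Qed.

Lemma mean_is_integral X e : mean_is X e -> (\int[P]_w (X w)%:E = e%:E)%E.
Proof. by move=> [Xi <-]; rewrite /Rintegral fineK //; exact: integrable_fin_num. Qed.

Lemma mean_is_cst c : mean_is (fun _ => c) c.
Proof.
split; first exact: finite_measure_integrable_cst.
by rewrite Rintegral_cst // [X in fine X](probability_setT P) mulr1.
Qed.

Lemma mean_isD X Y a b : mean_is X a -> mean_is Y b ->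
  mean_is (fun w => X w + Y w) (a + b).
Proof.
move=> [Xi <-] [Yi <-]; split; last by rewrite RintegralD.
by have := integrableD measurableT Xi Yi.
Qed.

Lemma mean_isZ k X a : mean_is X a -> mean_is (fun w => k * X w) (k * a).
Proof.
move=> [Xi <-]; split; last by rewrite RintegralZl.
by have := integrableZl measurableT k Xi.
Qed.

Lemma mean_isB X Y a b : mean_is X a -> mean_is Y b ->
  mean_is (fun w => X w - Y w) (a - b).
Proof.
move=> Xa Yb; have := mean_isD Xa (mean_isZ (-1) Yb).
by rewrite mulN1r; under eq_fun do rewrite mulN1r.
Qed.

Lemma mean_is_sum (I : Type) (s : seq I) (X : I -> O -> R) (a : I -> R) :
  (forall i, mean_is (X i) (a i)) ->
  mean_is (fun w => \sum_(i <- s) X i w) (\sum_(i <- s) a i).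
Proof.
move=> Xa; elim: s => [|i s IHs].
  by rewrite big_nil; under eq_fun do rewrite big_nil; exact: mean_is_cst.
by rewrite big_cons; under eq_fun do rewrite big_cons; exact: mean_isD.
Qed.

Lemma mean_is_ge0 X a : (forall w, 0 <= X w) -> mean_is X a -> 0 <= a.
Proof. by move=> X0 [_ <-]; exact: Rintegral_ge0. Qed.

Lemma mean_is_le X Y a b : (forall w, X w <= Y w) ->
  mean_is X a -> mean_is Y b -> a <= b.
Proof. by move=> XY [Xi <-] [Yi <-]; exact: le_Rintegral. Qed.

Definition mx_mean_is {p q : nat} (M : O -> 'M[R]_(p, q)) (C : 'M[R]_(p, q)) : Prop :=
  forall i j, mean_is (fun w => M w i j) (C i j).

Lemma mx_mean_is_Emx p q (M : O -> 'M[R]_(p, q)) :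
  (forall i j, P.-integrable setT (fun w => (M w i j)%:E)) ->
  mx_mean_is M (Emx P M).
Proof. by move=> Mi i j; split; [exact: Mi|rewrite mxE]. Qed.

Lemma mx_mean_is_unique p q (M : O -> 'M[R]_(p, q)) C1 C2 :
  mx_mean_is M C1 -> mx_mean_is M C2 -> C1 = C2.
Proof. by move=> MC1 MC2; apply/matrixP => i j; exact: mean_is_unique (MC1 i j) (MC2 i j). Qed.

Lemma mx_mean_is_cst p q (C : 'M[R]_(p, q)) : mx_mean_is (fun _ => C) C.
Proof. by move=> i j; exact: mean_is_cst. Qed.

Lemma mx_mean_is_tr p q (M : O -> 'M[R]_(p, q)) C :
  mx_mean_is M C -> mx_mean_is (fun w => (M w)^T) C^T.
Proof. by move=> MC i j; rewrite mxE; under eq_fun do rewrite mxE; exact: MC. Qed.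

Lemma mx_mean_isD p q (M N : O -> 'M[R]_(p, q)) C D :
  mx_mean_is M C -> mx_mean_is N D -> mx_mean_is (fun w => M w + N w) (C + D).
Proof.
by move=> MC ND i j; rewrite mxE; under eq_fun do rewrite mxE; exact: mean_isD.
Qed.

Lemma mx_mean_isZ p q k (M : O -> 'M[R]_(p, q)) C :
  mx_mean_is M C -> mx_mean_is (fun w => k *: M w) (k *: C).
Proof.
by move=> MC i j; rewrite mxE; under eq_fun do rewrite mxE; exact: mean_isZ.
Qed.

Lemma mx_mean_isN p q (M : O -> 'M[R]_(p, q)) C :
  mx_mean_is M C -> mx_mean_is (fun w => - M w) (- C).
Proof.
by rewrite -scaleN1r; under [X in _ -> mx_mean_is X _]eq_fun do rewrite -scaleN1r;
  exact: mx_mean_isZ.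
Qed.

Lemma mx_mean_isMl p q r (A : 'M[R]_(r, p)) (M : O -> 'M[R]_(p, q)) C :
  mx_mean_is M C -> mx_mean_is (fun w => A *m M w) (A *m C).
Proof.
move=> MC i j; rewrite mxE; under eq_fun do rewrite mxE.
by apply: mean_is_sum => k; exact: mean_isZ.
Qed.

Lemma mx_mean_isMr p q r (A : 'M[R]_(q, r)) (M : O -> 'M[R]_(p, q)) C :
  mx_mean_is M C -> mx_mean_is (fun w => M w *m A) (C *m A).
Proof.
move=> MC; have := mx_mean_is_tr (mx_mean_isMl A^T (mx_mean_is_tr MC)).
by rewrite trmx_mul !trmxK; under eq_fun do rewrite trmx_mul !trmxK.
Qed.

Lemma mean_is_trace p (M : O -> 'M[R]_p) C :
  mx_mean_is M C -> mean_is (fun w => \tr (M w)) (\tr C).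
Proof. by move=> MC; apply: mean_is_sum => k; exact: MC. Qed.

End Mean.

Lemma dotvE (R : realType) (m : nat) (u v : 'cV[R]_m) : dotv u v = \tr (u^T *m v).
Proof.
by rewrite /mxtrace big_ord1 mxE; apply: eq_bigr => i _; rewrite mxE.
Qed.

Lemma sqnormE (R : realType) (m : nat) (v : 'cV[R]_m) : sqnorm v = \tr (v *m v^T).
Proof. by rewrite trace_mulmx_trmx; apply: eq_bigr => i _; rewrite big_ord1. Qed.

Lemma sqnorm_dotv (R : realType) (m : nat) (v : 'cV[R]_m) : sqnorm v = dotv v v.
Proof. by apply: eq_bigr => i _; rewrite expr2. Qed.

(** At a minimum the difference quotients with [h > 0] are nonnegative, and the derivative is their
    right-hand limit. *)
Lemma derive_at_min_ge0 (R : realType) (V : normedModType R) (F : V -> R) (x v : V) :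
  (forall y, F x <= F y) -> derivable F x v -> 0 <= 'D_v F x.
Proof.
move=> Fmin dF; pose q h : R := h^-1 *: ((F \o shift x) (h *: v) - F x).
rewrite ['D_v F x](cvg_at_rightE q) //; apply: limr_ge.
  rewrite -(cvg_at_rightE q) //.
  apply: cvg_trans dF; apply: cvg_app.
  move=> A [e egt0 Ae]; exists e => // h he hgt0; apply: Ae => //.
  exact/lt0r_neq0.
near=> h; apply: mulr_ge0; last by rewrite subr_ge0; exact: Fmin.
by rewrite invr_ge0; apply: ltW; near: h; exists 1 => /=.
Unshelve. all: by end_near. Qed.

Section Gradient.
Variables (R : realType) (d n : nat).
Variables (f : 'I_n -> 'cV[R]_d -> R) (gradf : 'I_n -> 'cV[R]_d -> 'cV[R]_d).
Hypothesis hgrad : forall i, is_gradient (f i) (gradf i).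

Lemma dotv_gavg x v :
  dotv (gavg gradf x) v = n%:R^-1 * \sum_(i < n) dotv (gradf i x) v.
Proof.
rewrite dotvE /gavg linearZ /= -scalemxAl linearZ /=; congr (_ * _).
rewrite linear_sum mulmx_suml linear_sum.
by apply: eq_bigr => i _; rewrite dotvE.
Qed.

Lemma is_derive_favg x v : is_derive x v (favg f) (dotv (gavg gradf x) v).
Proof.
rewrite dotv_gavg.
have -> : favg f = n%:R^-1 \*: (\sum_(i < n) f i).
  by apply/funext => y; rewrite /favg /= fct_sumE.
apply: is_deriveZ; apply: is_derive_sum => i.
have [df dfE] := hgrad i x.
by apply: DeriveDef; [exact: diff_derivable|rewrite deriveE].
Qed.

Lemma gavg_min_eq0 xstar : (forall x, favg f xstar <= favg f x) ->
  gavg gradf xstar = 0.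
Proof.
move=> fmin; set g := gavg gradf xstar.
(* Along [- g] the derivative is [-|g|^2], which minimality makes nonnegative. *)
have gd := is_derive_favg xstar (- g).
have := derive_at_min_ge0 fmin (@ex_derive _ _ _ _ _ _ _ gd).
rewrite (@derive_val _ _ _ _ _ _ _ gd) -/g dotvE mulmxN linearN /= oppr_ge0 -dotvE.
rewrite -sqnorm_dotv sqnormE => g0; apply: trace_mulmx_trmx_eq0.
by apply/eqP; rewrite eq_le g0 trace_mulmx_trmx_ge0.
Qed.

End Gradient.

(** * One JacSketch step *)

Lemma sqnorm_ge0 (R : realType) (m : nat) (v : 'cV[R]_m) : 0 <= sqnorm v.
Proof. by rewrite sqnormE trace_mulmx_trmx_ge0. Qed.

Lemma sqnormZ (R : realType) (m : nat) k (v : 'cV[R]_m) :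
  sqnorm (k *: v) = k ^+ 2 * sqnorm v.
Proof. by rewrite mulr_sumr; apply: eq_bigr => i _; rewrite mxE exprMn. Qed.

Lemma sqnormB (R : realType) (m : nat) k (u v : 'cV[R]_m) :
  sqnorm (u - k *: v) = sqnorm u - 2 * k * dotv u v + k ^+ 2 * sqnorm v.
Proof.
rewrite /sqnorm /dotv !mulr_sumr -sumrB -big_split /=.
by apply: eq_bigr => i _; rewrite !mxE; ring.
Qed.

Lemma sqnormD_le (R : realType) (m : nat) (u v : 'cV[R]_m) :
  sqnorm (u + v) <= 2 * (sqnorm u + sqnorm v).
Proof.
rewrite /sqnorm -big_split mulr_sumr; apply: ler_sum => i _ /=.
rewrite !mxE -subr_ge0.
have -> : 2 * (u i 0 ^+ 2 + v i 0 ^+ 2) - (u i 0 + v i 0) ^+ 2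
  = (u i 0 - v i 0) ^+ 2 by ring.
exact: sqr_ge0.
Qed.

Section WeightedSpectralBounds.
Variables (R : realType) (n : nat) (W W12 : 'M[R]_n).
Hypotheses (hW12 : pos_def W12) (hW12sq : W12 *m W12 = W).

(** This is the Rayleigh bound for [W12 N W12] evaluated at [Y W12^-1]. *)
Lemma wnorm2_lambda_max (N : 'M[R]_n) (rho : R) : N^T = N ->
  (forall b, eigenvalue (W12 *m N *m W12) b -> b <= rho) ->
  forall (m : nat) (Y : 'M[R]_(m, n)), \tr (Y *m N *m Y^T) <= rho * wnorm2 W Y.
Proof.
move=> Ns Nrho m Y; have u := pos_def_unitmx hW12.
have Ws : W12^T = W12 := hW12.1.
have Ms : (W12 *m N *m W12)^T = W12 *m N *m W12 by rewrite !trmx_mul Ws Ns mulmxA.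
have := sym_quad_ub Ms Nrho (Y *m invmx W12).
rewrite -(wnorm2_sqrt hW12 hW12sq) !mulmxA mulmxKV // trmx_mul trmx_inv Ws.
by rewrite !mulmxA mulmxK.
Qed.

(* [E] is similar to the symmetric matrix [W12 E W12^-1]. *)
Lemma wnorm2_lambda_min (E : 'M[R]_n) (kappa : R) :
  E *m invmx W = invmx W *m E^T ->
  (forall b, eigenvalue E b -> kappa <= b) ->
  forall (m : nat) (Y : 'M[R]_(m, n)),
    kappa * wnorm2 W Y <= \tr (Y *m E *m invmx W *m Y^T).
Proof.
move=> Es Ekappa m Y; have u := pos_def_unitmx hW12.
have Ws : W12^T = W12 := hW12.1.
have WV : invmx W = invmx W12 *m invmx W12.
  by rewrite (invmx_sqrt hW12 hW12sq) trmx_inv Ws.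
(* The sign turns the lower bound into the available upper bound. Symmetry of [M] comes from
   [W12 E W12^-1 = W12 (E W^-1) W12] and the hypothesis on [E]. *)
pose M := - (W12 *m E *m invmx W12).
have Ms : M^T = M.
  rewrite /M linearN /= !trmx_mul trmx_inv Ws; congr (- _).
  rewrite -[W12 *m E *m _](mulmxKV u) -!mulmxA (mulmxA (invmx W12) (invmx W12)) -WV.
  by rewrite (mulmxA E) Es WV !mulmxA mulmxV // mul1mx.
have Mkappa b : eigenvalue M b -> b <= - kappa.
  move=> /eigenvalueP[v vM v0]; rewrite lerNr; apply: Ekappa.
  (* Similarity carries a left eigenvector [v] of [M] to the left eigenvector [v W12] of [E], with
     the opposite eigenvalue. *)
  apply/eigenvalueP; exists (v *m W12).
    apply: (can_inj (mulmxK (_ : invmx W12 \in unitmx))); rewrite ?unitmx_inv //.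
    rewrite -scalemxAl mulmxK // scaleNr -vM /M mulmxN opprK !mulmxA.
    by [].
  by apply: contra_neq v0 => vW0; rewrite -(mulmxK u v) vW0 mul0mx.
have := sym_quad_ub Ms Mkappa (Y *m invmx W12).
rewrite -(wnorm2_sqrt hW12 hW12sq) /M mulmxN mulNmx linearN mulNr lerN2 /=.
by rewrite !mulmxA mulmxKV // trmx_mul trmx_inv Ws WV !mulmxA.
Qed.

End WeightedSpectralBounds.

Lemma jac_ones (R : realType) (d n : nat)
    (gradf : 'I_n -> 'cV[R]_d -> 'cV[R]_d) x :
  n%:R^-1 *: (jac gradf x *m ones R n) = gavg gradf x.
Proof.
congr (_ *: _); apply/matrixP => a j; rewrite mxE summxE.
by apply: eq_bigr => i _; rewrite !mxE mulr1 ord1.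
Qed.

Section Step.
Variables (R : realType) (d n tau : nat).
Variables (gradf : 'I_n -> 'cV[R]_d -> 'cV[R]_d) (xstar : 'cV[R]_d).
Hypothesis gstar : gavg gradf xstar = 0.
Variables (W : 'M[R]_n) (hW : pos_def W).
Variables (dO : measure_display) (O : measurableType dO) (P : probability O R).
Variables (S : O -> 'M[R]_(n, tau)) (theta : O -> R).

Let e := ones R n.
Let Pi w := PiS W (S w).
Let t w := theta w *: (Pi w *m e).
Let T2 := Emx P (fun w => theta w ^+ 2 *: (Pi w *m e *m e^T *m (Pi w)^T)).
Let EPi := Emx P Pi.

Hypothesis hPi_int : forall i j, P.-integrable setT (fun w => (Pi w i j)%:E).
Hypothesis hthPi_int : forall i, P.-integrable setT (fun w => (t w i 0)%:E).
Hypothesis hth2_int : forall i j,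
  P.-integrable setT (fun w =>
    ((theta w ^+ 2 *: (Pi w *m e *m e^T *m (Pi w)^T)) i j)%:E).
Hypothesis hunbiased : Emx P t = e.

Lemma mean_Pi : mx_mean_is P Pi EPi.
Proof. exact: mx_mean_is_Emx. Qed.

Lemma mean_t : mx_mean_is P t e.
Proof. by rewrite -hunbiased; apply: mx_mean_is_Emx => i j; rewrite ord1. Qed.

Lemma mean_ttT : mx_mean_is P (fun w => t w *m (t w)^T) T2.
Proof.
have -> : (fun w => t w *m (t w)^T)
    = fun w => theta w ^+ 2 *: (Pi w *m e *m e^T *m (Pi w)^T).
  apply/funext => w; rewrite /t linearZ /= -scalemxAl -scalemxAr scalerA -expr2.
  by rewrite trmx_mul !mulmxA.
exact: mx_mean_is_Emx.
Qed.

Lemma mean_residual :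
  mx_mean_is P (fun w => (e - t w) *m (e - t w)^T) (T2 - e *m e^T).
Proof.
have -> : (fun w => (e - t w) *m (e - t w)^T)
    = fun w => e *m e^T - (e *m (t w)^T) - (t w *m e^T) + t w *m (t w)^T.
  apply/funext => w; rewrite linearB /= mulmxBr !mulmxBl.
  by rewrite opprB addrA addrAC; congr (_ + _); rewrite addrAC.
have -> : T2 - e *m e^T = e *m e^T - e *m e^T - e *m e^T + T2.
  by rewrite subrr sub0r addrC.
apply: mx_mean_isD mean_ttT; apply: mx_mean_isD.
  apply: mx_mean_isD; first exact: mx_mean_is_cst.
  by apply: mx_mean_isN; apply: mx_mean_isMl; apply: mx_mean_is_tr; exact: mean_t.
by apply: mx_mean_isN; apply: mx_mean_isMr; exact: mean_t.
Qed.

(** The matrix is the mean of the symmetric matrices [(e - t)(e - t)^T]. *)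
Lemma residual_sym : (T2 - e *m e^T)^T = T2 - e *m e^T.
Proof.
apply: mx_mean_is_unique mean_residual.
have := mx_mean_is_tr mean_residual.
by under eq_fun do rewrite trmx_mul trmxK.
Qed.

Lemma residual_quad_ge0 (m : nat) (Y : 'M[R]_(m, n)) :
  0 <= \tr (Y *m (T2 - e *m e^T) *m Y^T).
Proof.
apply: mean_is_ge0 (mean_is_trace (mx_mean_isMr _ (mx_mean_isMl Y mean_residual))) => w.
by rewrite mulmxA -mulmxA -trmx_mul trace_mulmx_trmx_ge0.
Qed.

Lemma EPi_selfadjoint : EPi *m invmx W = invmx W *m EPi^T.
Proof.
apply: mx_mean_is_unique (mx_mean_isMr _ mean_Pi) _.
under eq_fun do rewrite PiS_selfadjoint //.
exact: mx_mean_isMl (mx_mean_is_tr mean_Pi).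
Qed.

Lemma mean_proj_quad (m : nat) (Y : 'M[R]_(m, n)) :
  mean_is P (fun w => \tr (Y *m Pi w *m invmx W *m Y^T))
    (\tr (Y *m EPi *m invmx W *m Y^T)).
Proof. by apply: mean_is_trace; do 2 apply: mx_mean_isMr; exact: mx_mean_isMl mean_Pi. Qed.

Lemma mean_wnorm2_proj (m : nat) (Y : 'M[R]_(m, n)) :
  mean_is P (fun w => wnorm2 W (Y *m Pi w)) (\tr (Y *m EPi *m invmx W *m Y^T)).
Proof.
under eq_fun do rewrite wnorm2_proj ?PiS_idem ?PiS_selfadjoint //.
exact: mean_proj_quad.
Qed.

(** The squared norm is a linear function of [t t^T], hence integrable; the integral in the first
    smoothness hypothesis is therefore a finite real number. *)
Lemma mean_sqnorm_grad_diff (D : 'M[R]_(d, n)) :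
  mean_is P (fun w => sqnorm ((theta w / n%:R) *: (D *m Pi w *m e)))
    (n%:R^-1 ^+ 2 * \tr (D *m T2 *m D^T)).
Proof.
have -> : (fun w => sqnorm ((theta w / n%:R) *: (D *m Pi w *m e)))
    = fun w => n%:R^-1 ^+ 2 * \tr (D *m (t w *m (t w)^T) *m D^T).
  apply/funext => w; rewrite mulrC -scalerA sqnormZ sqnormE; congr (_ * \tr _).
  by rewrite -mulmxA scalemxAr -/(t w) trmx_mul !mulmxA.
by apply: mean_isZ; apply: mean_is_trace; apply: mx_mean_isMr; apply: mx_mean_isMl mean_ttT.
Qed.

Lemma mean_sqnorm_residual (Y : 'M[R]_(d, n)) :
  mean_is P (fun w => sqnorm (n%:R^-1 *: (Y *m (e - t w))))
    (n%:R^-1 ^+ 2 * \tr (Y *m (T2 - e *m e^T) *m Y^T)).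
Proof.
under eq_fun do rewrite sqnormZ sqnormE trmx_mul !mulmxA.
apply: mean_isZ; have := mean_is_trace (mx_mean_isMr Y^T (mx_mean_isMl Y mean_residual)).
by under eq_fun do rewrite !mulmxA.
Qed.

Variables (s : 'cV[R]_d * 'M[R]_(d, n)).
Let x := s.1.
Let J := s.2.
Let z := x - xstar.
Let D := jac gradf x - jac gradf xstar.
Let Y := J - jac gradf xstar.
Let g w := n%:R^-1 *: (J *m e) + (theta w / n%:R) *: ((jac gradf x - J) *m Pi w *m e).

(** Unbiasedness of the estimator: since [E t = e], the mean of [g] is [J e / n + (G x - J) e / n],
    the gradient of [f]. *)
Lemma mean_estimator : mean_is P (fun w => dotv z (g w)) (dotv z (gavg gradf x)).
Proof.
rewrite dotvE; under eq_fun do rewrite dotvE.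
apply: mean_is_trace; apply: mx_mean_isMl.
have -> : g = fun w => n%:R^-1 *: (J *m e) + n%:R^-1 *: ((jac gradf x - J) *m t w).
  by apply/funext => w; rewrite /g /t -scalemxAr scalerA [theta w / _]mulrC -(mulmxA _ (Pi w)).
have -> : gavg gradf x = n%:R^-1 *: (J *m e) + n%:R^-1 *: ((jac gradf x - J) *m e).
  by rewrite -scalerDr -mulmxDl addrC subrK jac_ones.
apply: mx_mean_isD; first exact: mx_mean_is_cst.
by apply: mx_mean_isZ; apply: mx_mean_isMl; exact: mean_t.
Qed.

Lemma estimator_split w :
  g w = (theta w / n%:R) *: (D *m Pi w *m e) + n%:R^-1 *: (Y *m (e - t w)).
Proof.
(* Optimality enters here: the Jacobian at [xstar] annihilates [e], so [J e] may be replaced by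
   [Y e]. *)
have Ye : n%:R^-1 *: (Y *m e) = n%:R^-1 *: (J *m e).
  by rewrite mulmxBl scalerBr jac_ones gstar subr0.
rewrite /g; have -> : jac gradf x - J = D - Y by rewrite /D /Y opprB addrA subrK.
rewrite mulmxBr scalerBr Ye /t -scalemxAr scalerA [n%:R^-1 * _]mulrC -!mulmxA.
by rewrite !mulmxBl scalerBr addrCA.
Qed.

(** The only loss is [|u + v|^2 <= 2 (|u|^2 + |v|^2)] on the two parts of [g]. Every term on the
    right has a mean computed above, which makes it a usable integrable majorant. *)
Lemma Psi_jac_step_le (L2 alpha : R) w :
  Psi gradf W xstar L2 alpha (jac_step gradf W S theta alpha s w)
  <= sqnorm z - 2 * alpha * dotv z (g w)
   + 2 * alpha ^+ 2 * (sqnorm ((theta w / n%:R) *: (D *m Pi w *m e))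
                       + sqnorm (n%:R^-1 *: (Y *m (e - t w))))
   + alpha / (2 * L2) * (wnorm2 W Y - \tr (Y *m Pi w *m invmx W *m Y^T)
                         + wnorm2 W (D *m Pi w)).
Proof.
rewrite /Psi /jac_step /= -/x -/J -/(g w) -/e -/(Pi w) -/(g w).
have -> : x - alpha *: g w - xstar = z - alpha *: g w by rewrite addrAC.
have -> : J + (jac gradf x - J) *m Pi w - jac gradf xstar = Y + (D - Y) *m Pi w.
  rewrite addrAC; congr (_ + _ *m _).
  by rewrite /D /Y opprB addrA subrK.
rewrite wnorm2_proj_split ?PiS_idem ?PiS_selfadjoint // lerD2r sqnormB lerD2l.
rewrite -mulrA mulrCA ler_wpM2l ?sqr_ge0 // estimator_split.
exact: sqnormD_le.
Qed.

End Step.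

(** * The scalar Lyapunov inequality and its iteration *)

(** Here [zz] and [yy] are the two squared errors, [delta] the gap in [f], [r = 1/n^2], and the
    other scalars are means of the terms in the one-step bound. The weight [c = alpha / (2 L2)]
    makes the terms in [delta] add up to at most [-2 alpha + 4 alpha^2 L1 + alpha <= 0] times
    [delta]; the second stepsize condition absorbs the [yy] terms. *)
Lemma lyapunov_contraction (R : realType)
    (alpha mu L1 L2 kappa rho r delta zz yy zg a b pd qd : R) :
  0 < L2 -> 0 <= alpha -> 4 * L1 * alpha <= 1 ->
  alpha * (4 * L2 * rho * r + mu) <= kappa ->
  0 <= delta -> 0 <= yy ->
  delta + mu / 2 * zz <= zg ->
  a <= 2 * L1 * delta -> b <= r * (rho * yy) ->
  kappa * yy <= pd -> qd <= 2 * L2 * delta ->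
  zz - 2 * alpha * zg + 2 * alpha ^+ 2 * (a + b)
    + alpha / (2 * L2) * (yy - pd + qd)
  <= (1 - mu * alpha) * (zz + alpha / (2 * L2) * yy).
Proof.
move=> L20 a0 aL1 ak d0 y0 hzg ha hb hp hq.
set c := alpha / (2 * L2).
have c0 : 0 <= c by rewrite divr_ge0 // mulr_ge0 // ltW.
have cL : c * (2 * L2) = alpha by rewrite /c divfK // mulf_neq0 // gt_eqF.
clearbody c.
have h1 : alpha * (delta + mu / 2 * zz) <= alpha * zg by rewrite ler_wpM2l.
have h2 : alpha ^+ 2 * (a + b) <= alpha ^+ 2 * (2 * L1 * delta + r * (rho * yy)).
  by rewrite ler_wpM2l ?sqr_ge0 // lerD.
have h3 : c * (yy - pd + qd) <= c * (yy - kappa * yy + 2 * L2 * delta).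
  by rewrite ler_wpM2l // lerD // lerB.
have h4 : alpha * delta * (4 * L1 * alpha) <= alpha * delta * 1.
  by rewrite ler_wpM2l // mulr_ge0.
have h5 : c * yy * (alpha * (4 * L2 * rho * r + mu)) <= c * yy * kappa.
  by rewrite ler_wpM2l // mulr_ge0.
have e3 : c * (yy - kappa * yy + 2 * L2 * delta)
    = c * yy - c * yy * kappa + alpha * delta by rewrite -[alpha in RHS]cL; ring.
have e5 : c * yy * (alpha * (4 * L2 * rho * r + mu))
    = 2 * alpha ^+ 2 * (r * (rho * yy)) + c * yy * alpha * mu.
  have -> : c * yy * (alpha * (4 * L2 * rho * r + mu))
    = 2 * alpha * (c * (2 * L2)) * (r * (rho * yy)) + c * yy * alpha * mu by ring.
  by rewrite cL; ring.
have -> : (1 - mu * alpha) * (zz + c * yy)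
   = zz - alpha * mu * zz + c * yy - c * yy * alpha * mu by ring.
rewrite e3 in h3; rewrite e5 in h5.
(* These identities give all hypotheses the same nonlinear monomials, so that the goal is linear in
   them. *)
have e2 : alpha ^+ 2 * (2 * L1 * delta + r * (rho * yy))
  = (alpha * delta * (4 * L1 * alpha)) / 2 + alpha ^+ 2 * (r * (rho * yy)) by field.
rewrite e2 in h2.
have e1 : alpha * (delta + mu / 2 * zz) = alpha * delta + alpha * mu * zz / 2 by ring.
rewrite e1 in h1.
have e6 : 2 * alpha ^+ 2 * (a + b) = 2 * (alpha ^+ 2 * (a + b)) by ring.
have e7 : 2 * alpha * zg = 2 * (alpha * zg) by ring.
have e8 : 2 * alpha ^+ 2 * (r * (rho * yy)) = 2 * (alpha ^+ 2 * (r * (rho * yy))) by ring.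
rewrite e6 e7; rewrite e8 in h5; lra.
Qed.

Lemma Psi_ge0 (R : realType) (d n : nat) gradf (W W12 : 'M[R]_n) xstar L2 alpha
    (s : 'cV[R]_d * 'M[R]_(d, n)) :
  pos_def W12 -> W12 *m W12 = W -> 0 < L2 -> 0 <= alpha ->
  0 <= Psi gradf W xstar L2 alpha s.
Proof.
move=> hW12 hW12sq L20 a0; rewrite addr_ge0 ?sqnorm_ge0 // mulr_ge0 //.
  by rewrite divr_ge0 // mulr_ge0 // ltW.
exact: wnorm2_ge0 hW12 hW12sq _ _.
Qed.

(* [EPsi] is not known to be measurable in the state, so the induction integrates
   an integrable majorant [U] of the next [Psi] instead. *)
Lemma EPsi_geometric (R : realType) (dO : measure_display) (O : measurableType dO)
    (P : probability O R) (d n tau : nat) gradf (W : 'M[R]_n)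
    (S : O -> 'M[R]_(n, tau)) (theta : O -> R) (xstar : 'cV[R]_d) (L2 alpha c : R) :
  0 <= c ->
  (forall s, 0 <= Psi gradf W xstar L2 alpha s) ->
  (forall s, exists U u,
     [/\ forall w, Psi gradf W xstar L2 alpha (jac_step gradf W S theta alpha s w) <= U w,
         mean_is P U u & u <= c * Psi gradf W xstar L2 alpha s]) ->
  forall k s, (0 <= EPsi P gradf W S theta xstar L2 alpha k s
     <= (c ^+ k * Psi gradf W xstar L2 alpha s)%:E)%E.
Proof.
move=> c0 Psi0 step; elim=> [|k IHk] s /=; first by rewrite expr0 mul1r !lee_fin Psi0 /=.
apply/andP; split.
  by apply: integral_ge0 => w _; case/andP: (IHk (jac_step gradf W S theta alpha s w)).
have [U [u [PsiU Uu uc]]] := step s.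
apply: (@le_trans _ _ (\int[P]_w (c ^+ k * U w)%:E)%E).
  apply: ge0_le_integral_nonmeasurable => w;
    case/andP: (IHk (jac_step gradf W S theta alpha s w)) => // _ /le_trans; apply.
  by rewrite lee_fin ler_wpM2l // exprn_ge0.
rewrite (mean_is_integral (mean_isZ _ Uu)) lee_fin exprSr -mulrA.
by rewrite ler_wpM2l // exprn_ge0.
Qed.

(** For an eigenvector [v], evaluating the quadratic form of [N] at [v W12] gives [rho |v|^2]. *)
Lemma psd_sandwich_eigenvalue_ge0 (R : realType) (n : nat) (N W12 : 'M[R]_n) (rho : R) :
  W12^T = W12 -> (forall Y : 'rV[R]_n, 0 <= \tr (Y *m N *m Y^T)) ->
  eigenvalue (W12 *m N *m W12) rho -> 0 <= rho.
Proof.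
move=> Ws N0 /eigenvalueP[v vN v0].
have := N0 (v *m W12); rewrite trmx_mul Ws.
have -> : v *m W12 *m N *m (W12 *m v^T) = rho *: (v *m v^T).
  by rewrite scalemxAl -vN !mulmxA.
rewrite linearZ /= pmulr_lge0 // lt_def trace_mulmx_trmx_ge0 andbT.
by apply: contra_neq v0 => /trace_mulmx_trmx_eq0.
Qed.

(** Combine [1 - q <= exp (- q)] with [ln (1 / eps) <= q k]. *)
Lemma linear_rate_le (R : realType) (q M eps : R) (k : nat) :
  0 < q -> q <= 1 -> q^-1 <= M -> 0 < eps -> M * ln (eps^-1) <= k%:R ->
  (1 - q) ^+ k <= eps.
Proof.
move=> q0 q1 qM eps0 Mk.
have lnk : ln (eps^-1) <= q * k%:R.
  rewrite mulrC -ler_pdivrMr // mulrC.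
  (* For [eps > 1] the logarithm is negative and [q^-1 <= M] no longer helps, but then the left side
     is at most [0 <= k]. *)
  have [l0|/ltW l0] := leP 0 (ln (eps^-1)).
    by apply: le_trans Mk; rewrite ler_wpM2r.
  by apply: le_trans (ler0n _ _); rewrite mulr_ge0_le0 // invr_ge0 ltW.
apply: (@le_trans _ _ (expR (- q) ^+ k)).
  by rewrite lerXn2r ?nnegrE ?expR_ge0 ?subr_ge0 // expR_ge1Dx.
rewrite -expRM_natl -[leRHS]lnK ?posrE // ler_expR -lerN2 -lnV ?posrE //.
by rewrite mulrN opprK mulrC.
Qed.

Theorem theorem3p6
  (R : realType) (d n tau : nat) (hn : (0 < n)%N)
  (f : 'I_n -> 'cV[R]_d -> R) (gradf : 'I_n -> 'cV[R]_d -> 'cV[R]_d)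
  (hgrad : forall i, is_gradient (f i) (gradf i))
  (xstar : 'cV[R]_d) (hmin : forall x, favg f xstar <= favg f x)
  (mu : R) (hmu : 0 < mu)
  (hsc : forall x, favg f x + dotv (gavg gradf x) (xstar - x)
                   + mu / 2 * sqnorm (xstar - x) <= favg f xstar)
  (W : 'M[R]_n) (hW : pos_def W)
  (dO : measure_display) (O : measurableType dO) (P : probability O R)
  (S : O -> 'M[R]_(n, tau)) (theta : O -> R)
  (hS : forall i j, measurable_fun setT (fun w => S w i j))
  (htheta : measurable_fun setT theta)
  (hPi_int : forall i j, P.-integrable setT (fun w => (PiS W (S w) i j)%:E))
  (hthPi_int : forall i,
     P.-integrable setT (fun w => ((theta w *: (PiS W (S w) *m ones R n)) i 0)%:E))
  (hth2_int : forall i j,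
     P.-integrable setT (fun w => ((theta w ^+ 2 *: (PiS W (S w) *m ones R n
                         *m (ones R n)^T *m (PiS W (S w))^T)) i j)%:E))
  (hunbiased : Emx P (fun w => theta w *: (PiS W (S w) *m ones R n)) = ones R n)
  (L1 L2 : R) (hL1 : 0 < L1) (hL2 : 0 < L2)
  (hexp1 : forall x,
     (\int[P]_w (sqnorm ((theta w / n%:R) *:
         ((jac gradf x - jac gradf xstar) *m PiS W (S w) *m ones R n)))%:E
      <= (2 * L1 * (favg f x - favg f xstar))%:E)%E)
  (hexp2 : forall x,
     (\int[P]_w (wnorm2 W ((jac gradf x - jac gradf xstar) *m PiS W (S w)))%:E
      <= (2 * L2 * (favg f x - favg f xstar))%:E)%E)
  (kappa : R) (hkappa : is_lambda_min (Emx P (fun w => PiS W (S w))) kappa)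
  (hkappa_pos : 0 < kappa)
  (W12 : 'M[R]_n) (hW12 : pos_def W12) (hW12sq : W12 *m W12 = W)
  (rho : R)
  (hrho : is_lambda_max
     (W12 *m (Emx P (fun w => theta w ^+ 2 *: (PiS W (S w) *m ones R n
                   *m (ones R n)^T *m (PiS W (S w))^T))
              - ones R n *m (ones R n)^T) *m W12) rho)
  (x0 : 'cV[R]_d) (J0 : 'M[R]_(d, n)) :
  let amax := Num.min (4 * L1)^-1 (kappa / (4 * L2 * rho / n%:R ^+ 2 + mu)) in
  (forall alpha, 0 <= alpha <= amax -> forall k : nat,
     (EPsi P gradf W S theta xstar L2 alpha k (x0, J0)
      <= ((1 - mu * alpha) ^+ k * Psi gradf W xstar L2 alpha (x0, J0))%:E)%E)
  /\
  (forall (eps : R) (k : nat), 0 < eps ->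
     Num.max (4 * L1 / mu) (kappa^-1 + 4 * rho * L2 / (kappa * mu * n%:R ^+ 2))
       * ln (eps^-1) <= k%:R ->
     (EPsi P gradf W S theta xstar L2 amax k (x0, J0)
      <= (eps * Psi gradf W xstar L2 amax (x0, J0))%:E)%E).
Proof.
move=> amax.
have gstar := gavg_min_eq0 hgrad hmin.
set e := ones R n in hth2_int hrho hunbiased hthPi_int hexp1 *.
set T2 := Emx P _ in hrho; set EPi := Emx P _ in hkappa.
have hn0 : (0 : R) < n%:R by rewrite ltr0n.
have rho_ge0 : 0 <= rho.
  apply: psd_sandwich_eigenvalue_ge0 hW12.1 _ hrho.1 => Y.
  exact: residual_quad_ge0.
have kappaP (m : nat) (Y : 'M[R]_(m, n)) :
    kappa * wnorm2 W Y <= \tr (Y *m EPi *m invmx W *m Y^T).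
  by apply: (wnorm2_lambda_min hW12 hW12sq) hkappa.2 _ _; exact: EPi_selfadjoint.
have rhoP (m : nat) (Y : 'M[R]_(m, n)) :
    \tr (Y *m (T2 - e *m e^T) *m Y^T) <= rho * wnorm2 W Y.
  by apply: (wnorm2_lambda_max hW12 hW12sq) hrho.2 _ _; exact: residual_sym.
(* Tested at [Y = W12], of squared weighted norm [n > 0]: the Pythagoras identity with [D = 0] shows
   that a projection does not increase the norm. The bound serves to prove [mu * amax <= 1], so that
   the contraction factor is nonnegative. *)
have kappa_le1 : kappa <= 1.
  have wI : wnorm2 W W12 = n%:R.
    by rewrite (wnorm2_sqrt hW12 hW12sq) mulmxV ?pos_def_unitmx // trmx1 mulmx1 mxtrace1.
  have : kappa * wnorm2 W W12 <= wnorm2 W W12.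
    apply: le_trans (kappaP _ W12) _.
    apply: mean_is_le (mean_proj_quad hPi_int W12) (mean_is_cst P _) => w.
    rewrite -subr_ge0.
    have := wnorm2_ge0 hW12 hW12sq (W12 + (0 - W12) *m PiS W (S w)).
    rewrite wnorm2_proj_split ?PiS_idem ?PiS_selfadjoint // mul0mx.
    by have -> : wnorm2 W (0 : 'M[R]_n) = 0; [rewrite /wnorm2 !mul0mx mxtrace0|rewrite addr0].
  by rewrite wI ger_pMl.
have den_gt0 : 0 < 4 * L2 * rho / n%:R ^+ 2 + mu.
  by rewrite ltr_wpDl // divr_ge0 ?exprn_ge0 ?ler0n // mulr_ge0 // mulr_ge0 // ltW.
have amax_gt0 : 0 < amax.
  by rewrite lt_min invr_gt0 mulr_gt0 //= divr_gt0.
have amax_L1 : 4 * L1 * amax <= 1.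
  rewrite mulrC -ler_pdivlMr ?mulr_gt0 // div1r.
  by rewrite ge_min lexx.
have amax_kappa : amax * (4 * L2 * rho / n%:R ^+ 2 + mu) <= kappa.
  by rewrite -ler_pdivlMr // ge_min lexx orbT.
have mu_amax : mu * amax <= 1.
  apply: le_trans kappa_le1; apply: le_trans amax_kappa.
  rewrite mulrC ler_pM2l // lerDr.
  by rewrite divr_ge0 ?exprn_ge0 ?ler0n // mulr_ge0 // mulr_ge0 // ltW.
have rate (alpha : R) : 0 <= alpha <= amax -> forall k s,
   (EPsi P gradf W S theta xstar L2 alpha k s
      <= ((1 - mu * alpha) ^+ k * Psi gradf W xstar L2 alpha s)%:E)%E.
  move=> /andP[a0 aM].
  (* The lower bound is carried along because the comparison of integrals requires nonnegative
     integrands. *)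
  suff Q k s : (0 <= EPsi P gradf W S theta xstar L2 alpha k s
      <= ((1 - mu * alpha) ^+ k * Psi gradf W xstar L2 alpha s)%:E)%E.
    by move=> k s; case/andP: (Q k s).
  apply: EPsi_geometric => [|{}s|{}s].
  - by rewrite subr_ge0; apply: le_trans mu_amax; rewrite ler_pM2l.
  - exact: Psi_ge0 hW12 hW12sq _ _.
  pose x := s.1; pose z := x - xstar; pose Y := s.2 - jac gradf xstar.
  pose D := jac gradf x - jac gradf xstar.
  pose delta := favg f x - favg f xstar.
  have mA := mean_sqnorm_grad_diff hth2_int D.
  have mB := mean_sqnorm_residual hthPi_int hth2_int hunbiased Y.
  have mg := mean_estimator gradf xstar hthPi_int hunbiased s.
  have mY := mean_proj_quad hPi_int Y.
  have mD := mean_wnorm2_proj hW hPi_int D.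
  (* The majorant is read off from the one-step bound, and its mean is assembled from the means
     above. *)
  do 2 eexists; split.
  - by move=> w; exact: (Psi_jac_step_le gstar hW).
  - apply: mean_isD (mean_isZ _ (mean_isD (mean_isB (mean_is_cst _ _) mY) mD)).
    apply: mean_isD (mean_isZ _ (mean_isD mA mB)).
    exact: mean_isB (mean_is_cst _ _) (mean_isZ _ mg).
  apply: (@lyapunov_contraction _ _ _ L1 L2 kappa rho (n%:R^-1 ^+ 2) delta) => //.
  - by apply: le_trans amax_L1; rewrite ler_pM2l // mulr_gt0.
  - rewrite exprVn; apply: le_trans amax_kappa.
    by rewrite ler_pM2r.
  - by rewrite subr_ge0.
  - exact: wnorm2_ge0 hW12 hW12sq _ _.
  (* Strong convexity, rewritten in terms of [z = x - xstar], bounds the mean inner product from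
     below. *)
  - have := hsc x; rewrite -lerBrDl -/x.
    have -> : sqnorm (xstar - x) = sqnorm z.
      by rewrite -[xstar - x]opprB -scaleN1r sqnormZ sqrrN expr1n mul1r.
    have -> : dotv (gavg gradf x) (xstar - x) = - dotv z (gavg gradf x).
      rewrite /dotv -sumrN; apply: eq_bigr => i _; rewrite !mxE; ring.
    rewrite /delta; lra.
  - by have := hexp1 x; rewrite (mean_is_integral mA) lee_fin.
  - by rewrite ler_pM2l ?exprn_gt0 ?invr_gt0.
  - by have := hexp2 x; rewrite (mean_is_integral mD) lee_fin.
split=> [alpha ha k|eps k eps0 hk]; first exact: rate.
have amax_ge0 : 0 <= amax <= amax by rewrite lexx ltW.
apply: le_trans (rate _ amax_ge0 k _) _; rewrite lee_fin.
apply: ler_wpM2r; first exact: Psi_ge0 hW12 hW12sq hL2 (ltW amax_gt0).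
apply: linear_rate_le hk => //; first by rewrite mulr_gt0.
(* Whichever term attains the minimum in [amax], the inverse of [mu * amax] is the corresponding
   term of the maximum. *)
rewrite invfM /amax; case: (leP (4 * L1)^-1) => _; rewrite le_max; apply/orP; [left|right].
  by rewrite invrK mulrC.
rewrite le_eqVlt; apply/orP; left; apply/eqP.
field; rewrite !gt_eqF // ltr_wpDl ?mulr_gt0 ?exprn_gt0 //.
by rewrite mulr_ge0 // mulr_ge0 // ltW.
Qed.
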